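(* Let $\lambda$ be a partition. The Schur function $S_\lambda$ is doubly symmetric if and only if $\lambda$ is a staircase shape.
   Context: A partition $\lambda$ is a staircase shape if $\lambda=(m,m-1,\ldots,2,1)$ for some integer $m\ge0$ ($m=0$ giving the empty partition). Symmetric functions are taken over $\mathbb{Q}$, with basis the Schur functions $S_\lambda$ indexed by all partitions. Hook Schur functions: for finite, possibly empty, lists of variables $X=(x_1,\ldots,x_k)$, $Y=(y_1,\ldots,y_\ell)$, a $(k,\ell)$-semistandard tableau of shape $\lambda$ is a filling of the Young diagram of $\lambda$ with entries from the ordered alphabet $1<2<\cdots<k<1'<\cdots<\ell'$ such that entries are non-decreasing in each row and each column, unprimed symbols may repeat in rows but not in columns, and primed symbols may repeat in columns but not in rows. Then $HS_\lambda(X;Y)=\sum_T x^T$, summed over all such tableaux $T$, where $x^T=\prod_j x_j^{\#\{j \text{ in } T\}}\prod_j y_j^{\#\{j'\text{ in }T\}}$. A symmetric function $\sum_\lambda m_\lambda S_\lambda$ is doubly symmetric if for all finite (possibly empty) sets of variables $X,Y$ one has $\sum_\lambda m_\lambda S_\lambda(X,Y)=\sum_\lambda m_\lambda HS_\lambda(X;Y)$, where $S_\lambda(X,Y)$ is the Schur polynomial in all the variables of $X$ and $Y$ together. *)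

(* Defs.v *)
From HB Require Import structures.
From mathcomp Require Import all_boot all_algebra.
From mathcomp Require Import freeg mpoly.

Set Implicit Arguments.
Unset Strict Implicit.
Unset Printing Implicit Defensive.

Import GRing.Theory.
Local Open Scope ring_scope.

Definition is_part (s : seq nat) : bool := sorted geq s && (0%N \notin s).

Record intpart : Type := IntPart { parts :> seq nat; _ : is_part parts }.

HB.instance Definition _ := [isSub for parts].
HB.instance Definition _ := [Countable of intpart by <:].

Definition staircase (la : intpart) : Prop :=
  exists m : nat, parts la = rev (iota 1 m).

(* Boxes (i, j) with i < size la and j < la_i, both 0-based. *)
Definition box (la : intpart) : finType :=
  {i : 'I_(size la) & 'I_(nth 0%N la i)}.

Definition brow (la : intpart) (b : box la) : nat := tag b.
Definition bcol (la : intpart) (b : box la) : nat := tagged b.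

Definition filling (la : intpart) (n : nat) := {ffun box la -> 'I_n}.

Definition filling_weight (la : intpart) (n : nat) (T : filling la n) :
    {mpoly rat[n]} :=
  \prod_(i < n) 'X_i ^+ #|[set b | T b == i]|.

Definition same_row_lt (la : intpart) (b c : box la) : bool :=
  (brow b == brow c) && (bcol b < bcol c)%N.

Definition same_col_lt (la : intpart) (b c : box la) : bool :=
  (bcol b == bcol c) && (brow b < brow c)%N.

Definition semistandard (la : intpart) (n : nat) (T : filling la n) : bool :=
  [forall b, forall c,
    (same_row_lt b c ==> (T b <= T c)%N) &&
    (same_col_lt b c ==> (T b < T c)%N)].

Definition schur_poly (n : nat) (la : intpart) : {mpoly rat[n]} :=
  \sum_(T : filling la n | semistandard T) filling_weight T.

(* The alphabet 1 < ... < k < 1' < ... < l' is 'I_(k + l): the values below k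
   are the unprimed symbols, and k, ..., k + l - 1 are the primed ones. The
   variable 'X_i is accordingly x_(i+1) if i < k and y_(i-k+1) otherwise. *)
Definition hook_semistandard (k l : nat) (la : intpart)
    (T : filling la (k + l)) : bool :=
  [forall b, forall c,
    (same_row_lt b c ==>
       (T b <= T c)%N && ((k <= T b)%N ==> (T b != T c))) &&
    (same_col_lt b c ==>
       (T b <= T c)%N && ((T b < k)%N ==> (T b != T c)))].

Definition hook_schur_poly (k l : nat) (la : intpart) : {mpoly rat[k + l]} :=
  \sum_(T : filling la (k + l) | hook_semistandard T) filling_weight T.

(* A symmetric function over rat is given by its finitely many coefficients
   in the Schur basis. *)
Definition symfun := {freeg intpart / rat}.

Definition schur (la : intpart) : symfun := << la >>.

Definition doubly_symmetric (f : symfun) : Prop :=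
  forall k l : nat,
    fglift (schur_poly (k + l)) f = fglift (@hook_schur_poly k l) f.

(* Main.v *)
(* A one-letter step in a (k,l)-tableau adds a horizontal strip (unprimed letter)
   or a vertical strip (primed letter), so both sides of the identity are entries
   of products of transfer matrices indexed by partitions. Unprimed transfer
   matrices commute by the Bender-Knuth involution, and the primed one at [x] is
   the inverse of the unprimed one at [- x], whence all of them commute and the
   alphabet may be reordered freely. For a staircase, the horizontal and the
   vertical strips that can be removed are the same, namely the sets of corners,
   so the largest letter may be primed or not; moving each letter to the top in
   turn shows that the primes are irrelevant.

   Conversely, with a single primed letter [y], the coefficient of [y ^ 2] is a
   vanishing linear combination of Schur polynomials in [X]; by triangularity of
   the Kostka numbers the horizontal and the vertical strips of size 2 that can
   be removed from [la] coincide. A gap [la_i - la_(i+1) >= 2] gives a removable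
   horizontal domino, and the last equality [la_i = la_(i+1)] a vertical one. *)

Require Import Defs.
From mathcomp Require Import all_boot all_algebra.
From mathcomp Require Import freeg mpoly zify ring.

Set Implicit Arguments.
Unset Strict Implicit.
Unset Printing Implicit Defensive.

Import GRing.Theory.
Local Open Scope ring_scope.

(** * Horizontal and vertical strips *)

Section BoundedPartitions.

Variables N M : nat.

Definition is_bpart (f : {ffun 'I_N -> 'I_M.+1}) : bool :=
  [forall i : 'I_N, forall j : 'I_N, (i <= j)%N ==> (f j <= f i)%N].

(** The bounds, at most [N] rows and parts at most [M], make the type finite: transfer matrices are
    then square matrices, for which one-sided inverses are two-sided. *)
Definition bpart := {f : {ffun 'I_N -> 'I_M.+1} | is_bpart f}.

Implicit Types p q r : bpart.

Definition row p (i : nat) : nat :=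
  if insub i is Some i' then val p i' else 0%N.

Lemma row_ord p (i : 'I_N) : row p i = val p i.
Proof. by rewrite /row valK. Qed.

Lemma row_default p i : (N <= i)%N -> row p i = 0%N.
Proof. by move=> Ni; rewrite /row insubF // ltnNge Ni. Qed.

Lemma row_le p i j : (i <= j)%N -> (row p j <= row p i)%N.
Proof.
move=> ij; have [jN|/row_default -> //] := ltnP j N.
have iN := leq_ltn_trans ij jN.
rewrite (row_ord p (Ordinal iN)) (row_ord p (Ordinal jN)).
have /forallP/(_ (Ordinal iN))/forallP/(_ (Ordinal jN)) := valP p.
by move/implyP; apply.
Qed.

Lemma row_bound p i : (row p i <= M)%N.
Proof. by rewrite /row; case: insub => // i'; rewrite -ltnS. Qed.

Lemma bpart_eq p q : (forall i, (i < N)%N -> row p i = row q i) -> p = q.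
Proof.
move=> pq; apply/val_inj/ffunP => i; apply/val_inj.
by have := pq i (ltn_ord i); rewrite !row_ord.
Qed.

Lemma is_bpart0 : is_bpart [ffun=> ord0].
Proof. by apply/forallP=> i; apply/forallP=> j; rewrite !ffunE implybT. Qed.

Definition bpart0 : bpart := Sub [ffun=> ord0] is_bpart0.

(** A total constructor, with junk value when [f] is not weakly decreasing or exceeds [M];
    [row_mk_bpart] is its specification. *)
Definition mk_bpart (f : nat -> nat) : bpart :=
  insubd bpart0 [ffun i : 'I_N => inord (f i)].

Lemma row_mk_bpart (f : nat -> nat) i :
  (forall j k, (j <= k < N)%N -> (f k <= f j)%N) ->
  (forall j, (j < N)%N -> (f j <= M)%N) ->
  (i < N)%N -> row (mk_bpart f) i = f i.
Proof.
move=> f_le f_bound iN; rewrite (row_ord _ (Ordinal iN)) val_insubd ifT.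
  by rewrite ffunE inordK // ltnS f_bound.
apply/forallP=> j; apply/forallP=> k; apply/implyP=> jk.
by rewrite !ffunE !inordK ?ltnS ?f_bound ?f_le // jk /=.
Qed.

Lemma row_empty i : row bpart0 i = 0%N.
Proof. by rewrite /row; case: insub => //= i'; rewrite ffunE. Qed.

Definition size_of p : nat := (\sum_(i < N) row p i)%N.

Lemma size_ofD1 p i : (i < N)%N ->
  size_of p = (row p i + \sum_(j < N | j != i :> nat) row p j)%N.
Proof. by move=> iN; rewrite /size_of (bigD1 (Ordinal iN)). Qed.

Definition hstrip p q : bool :=
  [forall i : 'I_N, row p i.+1 <= row q i <= row p i]%N.

Definition vstrip p q : bool :=
  [forall i : 'I_N, row q i <= row p i <= (row q i).+1]%N.

Lemma hstripP p q :
  reflect (forall i, row p i.+1 <= row q i <= row p i)%N (hstrip p q).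
Proof.
apply: (iffP forallP) => [pq i|pq i //].
have [iN|Ni] := ltnP i N; first exact: (pq (Ordinal iN)).
by rewrite !row_default // ltnW.
Qed.

Lemma vstripP p q :
  reflect (forall i, row q i <= row p i <= (row q i).+1)%N (vstrip p q).
Proof.
apply: (iffP forallP) => [pq i|pq i //].
have [iN|Ni] := ltnP i N; first exact: (pq (Ordinal iN)).
by rewrite !row_default.
Qed.

(** Interlacing forces monotonicity: for [j < k], [f k <= row p k <= row p j.+1 <= f j]. *)
Lemma interlacing_bpart p (f : nat -> nat) :
  (forall i, (i < N)%N -> row p i.+1 <= f i <= row p i)%N ->
  forall i, (i < N)%N -> row (mk_bpart f) i = f i.
Proof.
move=> pf i; apply: row_mk_bpart => [j k /andP[jk kN]|j jN]; last first.
  by case/andP: (pf j jN) => _ /leq_trans; apply; apply: row_bound.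
move: jk; rewrite leq_eqVlt => /predU1P[-> //|jk].
have /andP[pfj _] := pf j (ltn_trans jk kN); apply: leq_trans pfj.
by case/andP: (pf k kN) => _ /leq_trans; apply; apply: row_le.
Qed.

Lemma leq_size_of p q : (forall i, row q i <= row p i)%N ->
  (size_of q <= size_of p)%N.
Proof. by move=> qp; apply: leq_sum. Qed.

Definition strip (s : bool) := if s then vstrip else hstrip.

Lemma strip_sub s p q : strip s p q -> forall i, (row q i <= row p i)%N.
Proof.
by case: s => [/vstripP|/hstripP] pq i; case/andP: (pq i).
Qed.

Lemma strip_size s p q : strip s p q -> (size_of q <= size_of p)%N.
Proof. by move/strip_sub/leq_size_of. Qed.

(* The Bender-Knuth reflection: in a chain [p >= q >= r] of two horizontal
   strips, row [i] of [q] ranges over an interval with end points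
   [max (row r i) (row p i.+1)] and [min (row p i) (row r i.-1)]. *)
Definition bk_lower p r i := maxn (row r i) (row p i.+1).
Definition bk_upper p r i :=
  if i is i'.+1 then minn (row p i) (row r i') else row p i.

Definition bk p r q : bpart :=
  mk_bpart (fun i => bk_lower p r i + bk_upper p r i - row q i)%N.

Lemma bk_range p r q i : hstrip p q -> hstrip q r ->
  (bk_lower p r i <= row q i <= bk_upper p r i)%N.
Proof.
move=> /hstripP pq /hstripP qr; rewrite /bk_lower /bk_upper.
by move: (pq i) (qr i) (pq i.-1) (qr i.-1); case: i => [|i] /=; lia.
Qed.

Lemma row_bk p r q i : hstrip p q -> hstrip q r -> (i < N)%N ->
  row (bk p r q) i = (bk_lower p r i + bk_upper p r i - row q i)%N.
Proof.
move=> pq qr; apply: (interlacing_bpart (p := p)) => j _.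
move: (bk_range j pq qr); rewrite /bk_lower /bk_upper.
by case: j => [|j]; lia.
Qed.

Lemma bk_strip p r q : hstrip p q -> hstrip q r ->
  hstrip p (bk p r q) && hstrip (bk p r q) r.
Proof.
move=> pq qr; apply/andP; split; apply/forallP => /= i.
  rewrite row_bk //; move: (bk_range i pq qr).
  by rewrite /bk_lower /bk_upper; case: (val i) => [|j]; lia.
rewrite (row_bk pq qr (ltn_ord i)).
have iN := ltn_ord i; have := bk_range i pq qr.
have [i1N|Ni] := ltnP i.+1 N.
  rewrite row_bk //; have := bk_range i.+1 pq qr.
  rewrite /bk_lower /bk_upper; case: (val i) => [|j]; lia.
rewrite (row_default (bk _ _ _) Ni).
by rewrite /bk_lower /bk_upper; case: (val i) => [|j]; lia.
Qed.

Lemma bkK p r q : hstrip p q -> hstrip q r -> bk p r (bk p r q) = q.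
Proof.
move=> pq qr; have /andP[pq' q'r] := bk_strip pq qr.
apply: bpart_eq => i iN; rewrite !row_bk //.
by have := bk_range i pq qr; lia.
Qed.

(** The maximum of [row r i] and [row p i.+1] occurs in [bk_lower] at [i], their minimum in
    [bk_upper] at [i.+1], and together they give [row r i + row p i.+1]. The extra terms on both
    sides are the boundary of this regrouping; they vanish at [n = N]. *)
Lemma bk_sum p r n : (forall i, row r i <= row p i)%N ->
  (\sum_(i < n) (bk_lower p r i + bk_upper p r i) +
    (if n is n'.+1 then minn (row p n) (row r n') else row p n) =
  \sum_(i < n) (row p i + row r i) + row p n)%N.
Proof.
move=> rp; elim: n => [|n IHn]; first by rewrite !big_ord0.
rewrite !big_ord_recr /=; move: IHn (rp n).
move: (\sum_(i < n) (bk_lower _ _ _ + _))%N (\sum_(i < n) (row _ _ + _))%N.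
by rewrite /bk_lower /bk_upper; case: n => [|n] S1 S2; lia.
Qed.

(** Equivalently, the reflection exchanges the sizes of the two strips, hence the exponents of the
    two letters. *)
Lemma bk_size p r q : hstrip p q -> hstrip q r ->
  (size_of (bk p r q) + size_of q = size_of p + size_of r)%N.
Proof.
move=> pq qr; rewrite /size_of -big_split /= -big_split /=.
have rp i : (row r i <= row p i)%N.
  exact: leq_trans (strip_sub (s := false) qr i) (strip_sub (s := false) pq i).
have := bk_sum N rp; rewrite (row_default p (leqnn N)).
rewrite addn0 => <-; rewrite (_ : (if N is _.+1 then _ else _) = 0%N).
  rewrite addn0; apply: eq_bigr => i _; rewrite row_bk //.
  by have := bk_range i pq qr; lia.
by case: (N) => // n; rewrite min0n.
Qed.

(** If [q / r] is a vertical strip, row [i] of [q] is [row r i] or [(row r i).+1], and subtracting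
    from [(row r i).*2.+1] swaps the two values. This is the sign-reversing involution behind the
    cancellation in [transfer_hv_inv]. *)
Definition toggle r i q : bpart :=
  mk_bpart (fun j => if j == i then (row r i).*2.+1 - row q i else row q j)%N.

Section Toggle.

Variables (p r : bpart) (i : nat).
Hypotheses (iN : (i < N)%N) (ri_lt_pi : (row r i < row p i)%N).
Hypothesis tail_eq : forall j, (i < j)%N -> row p j = row r j.

Lemma row_toggle q j : hstrip p q -> vstrip q r -> (j < N)%N ->
  row (toggle r i q) j =
    (if j == i then (row r i).*2.+1 - row q i else row q j)%N.
Proof.
move=> /hstripP pq /vstripP qr; apply: (interlacing_bpart (p := p)) => k _.
case: (eqVneq k i) => [->|_]; last exact: pq.
by have := tail_eq (ltnSn i); move: (row_le r (leqnSn i)) (pq i) (qr i); lia.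
Qed.

(** Since [i] is the last row where [p] and [r] differ, [row p i.+1 = row r i.+1 <= row r i < row p
    i]; so both values allowed by the vertical strip also satisfy the horizontal condition. *)
Lemma toggle_strip q : hstrip p q -> vstrip q r ->
  hstrip p (toggle r i q) && vstrip (toggle r i q) r.
Proof.
move=> pq qr; apply/andP; split; apply/forallP => /= j.
  rewrite row_toggle //; case: eqVneq => [->|_]; last exact: (hstripP _ _ pq).
  have := tail_eq (ltnSn i); move: (row_le r (leqnSn i)).
  by move: (hstripP _ _ pq i) (vstripP _ _ qr i); lia.
rewrite row_toggle //; case: eqVneq => [->|_]; last exact: (vstripP _ _ qr).
by move: (vstripP _ _ qr i); lia.
Qed.

Lemma toggleK q : hstrip p q -> vstrip q r -> toggle r i (toggle r i q) = q.
Proof.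
move=> pq qr; have /andP[pq' q'r] := toggle_strip pq qr.
apply: bpart_eq => j jN; rewrite !row_toggle //.
by case: eqVneq => [->|//]; rewrite eqxx; move: (vstripP _ _ qr i); lia.
Qed.

Lemma toggle_size q : hstrip p q -> vstrip q r ->
  (size_of (toggle r i q) + row q i =
     size_of q + ((row r i).*2.+1 - row q i))%N.
Proof.
move=> pq qr; rewrite !(size_ofD1 _ iN) row_toggle // eqxx.
rewrite (eq_bigr (fun j : 'I_N => row q j)).
  by move: (\sum_(j < N | _) _)%N => S; lia.
by move=> j ji; rewrite row_toggle // ifN.
Qed.

End Toggle.

Lemma toggle_exists p r : (forall i, row r i <= row p i)%N -> p != r ->
  exists2 i, (i < N)%N &
    (row r i < row p i)%N /\ forall j, (i < j)%N -> row p j = row r j.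
Proof.
move=> rp p_neq_r; pose P i := (i < N)%N && (row r i < row p i)%N.
have exP : exists i, P i.
  have [/existsP[i ri]|/existsPn r_ge_p] :=
    boolP [exists i : 'I_N, row r i < row p i]%N.
    by exists i; rewrite /P ltn_ord.
  case/eqP: p_neq_r; apply: bpart_eq => i iN.
  by apply/eqP; rewrite eqn_leq rp andbT leqNgt (r_ge_p (Ordinal iN)).
have ubP i : P i -> (i <= N)%N by case/andP=> /ltnW.
case: (ex_maxnP exP ubP) => i /andP[iN ri] imax; exists i => //.
split=> // j ij.
apply/eqP; rewrite eqn_leq rp andbT leqNgt; apply/negP => rj.
have [jN|Nj] := ltnP j N; last by rewrite !row_default in rj.
by have := imax j; rewrite /P jN rj leqNgt ij => /(_ isT).
Qed.

(** * Transfer matrices *)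

Section Transfer.

Variable R : comNzRingType.
Implicit Types (x y : R).

(* Matrix coefficient of adding the letter [a] on top of the shape [q]; the
   Boolean [a.1] tells whether the letter is primed. *)
Definition transfer (a : bool * R) p q : R :=
  (strip a.1 p q)%:R * a.2 ^+ (size_of p - size_of q).

Lemma transfer_hh_comm x y p r :
  \sum_q transfer (false, x) p q * transfer (false, y) q r =
  \sum_q transfer (false, y) p q * transfer (false, x) q r.
Proof.
pose S := [pred q | hstrip p q && hstrip q r].
have restrict u v : \sum_q transfer (false, u) p q * transfer (false, v) q r =
    \sum_(q in S) u ^+ (size_of p - size_of q) * v ^+ (size_of q - size_of r).
  rewrite [RHS]big_mkcond; apply: eq_bigr => q _; rewrite /transfer /= inE.
  by case: hstrip; rewrite ?mul0r //=; case: hstrip;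
    rewrite ?mul1r ?mul0r ?mulr0.
rewrite !restrict (reindex_onto (bk p r) (bk p r)) /=; last first.
  by move=> q /andP[pq qr]; rewrite bkK.
apply: eq_big => [q|q].
  rewrite !inE; apply/idP/idP => [/andP[/andP[pq qr] /eqP <-]|].
    exact: bk_strip.
  by move=> /andP[pq qr]; rewrite bk_strip // bkK //=.
move=> /andP[/andP[pq' q'r] /eqP q'K].
have /andP[pq qr] := bk_strip pq' q'r; rewrite q'K in pq qr.
rewrite mulrC; have := bk_size pq qr.
have := strip_size (s := false) pq; have := strip_size (s := false) qr.
by move=> ? ? ?; congr (_ ^+ _ * _ ^+ _); lia.
Qed.

(** This is the relation H(x) E(-x) = 1 between complete and elementary generating functions. For
    [p != r] the chains cancel in pairs under [toggle]; for [p = r] only [q = p] survives. *)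
Lemma transfer_hv_inv x p r :
  \sum_q transfer (false, x) p q * transfer (true, - x) q r = (p == r)%:R.
Proof.
have [<-|p_neq_r] := eqVneq p r.
  rewrite (bigD1 p) //= big1 => [|q q_neq_p].
    rewrite /transfer /= subnn !expr0 !mulr1 addr0.
    have -> : hstrip p p by apply/hstripP => i; rewrite leqnn row_le.
    have -> : vstrip p p by apply/vstripP => i; rewrite leqnn leqnSn.
    by rewrite mulr1.
  rewrite /transfer /=; case: hstripP => pq; last by rewrite !mul0r.
  case: vstripP => qp; last by rewrite mul0r mulr0.
  case/eqP: q_neq_p; apply: bpart_eq => i _.
  by move: (pq i) (qp i); lia.
have [|/forallPn/= [i rpi]] :=
  boolP [forall i : 'I_N, row r i <= row p i]%N; last first.
  rewrite big1 // => q _; rewrite /transfer /=.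
  case: hstripP => pq; last by rewrite !mul0r.
  case: vstripP => qr; last by rewrite mul0r mulr0.
  by move: rpi (pq i) (qr i); lia.
move=> /forallP rp.
have {}rp i : (row r i <= row p i)%N.
  by have [iN|Ni] := ltnP i N; [exact: (rp (Ordinal iN))|rewrite !row_default].
have [i iN [ri tail_eq]] := toggle_exists rp p_neq_r.
pose S := [pred q | hstrip p q && vstrip q r].
pose F q := x ^+ (size_of p - size_of q) * (- x) ^+ (size_of q - size_of r).
transitivity (\sum_(q in S) F q).
  rewrite [RHS]big_mkcond; apply: eq_bigr => q _; rewrite /transfer /= inE.
  by case: hstrip; rewrite ?mul0r //=; case: vstrip;
    rewrite ?mul1r ?mul0r ?mulr0.
(* Toggling matches the chains with [row q i = row r i] to the others; it moves one box from one
   strip to the other, so the sign changes. *)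
rewrite (bigID [pred q | row q i == row r i]) /=.
rewrite [X in _ + X](reindex_onto (toggle r i) (toggle r i)) /=; last first.
  by move=> q /andP[/andP[pq qr] _]; rewrite (toggleK iN ri tail_eq).
rewrite (eq_bigl [pred q | S q && (row q i == row r i)]) => [|q] /=; last first.
  by rewrite inE.
rewrite [X in _ + X](eq_bigl [pred q | S q && (row q i == row r i)]) => [|q] /=.
  rewrite -big_split /= big1 // => q /andP[/andP[pq qr] /eqP qi].
  have /andP[pq' q'r] := toggle_strip iN ri tail_eq pq qr.
  have := toggle_size iN ri tail_eq pq qr; rewrite qi /F.
  have := strip_size (s := false) pq'; have := strip_size (s := true) qr.
  move=> rq qp eq_size.
  have -> : (size_of (toggle r i q) - size_of r = (size_of q - size_of r).+1)%N.
    by lia.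
  have -> : (size_of p - size_of q = (size_of p - size_of (toggle r i q)).+1)%N.
    by lia.
  rewrite !exprS; move: (x ^+ (_ - _)) ((- x) ^+ (_ - _)) => u v.
  by ring.
rewrite !inE; apply/idP/idP.
  move=> /andP[/andP[/andP[pq' q'r] q'i] /eqP q'K].
  have /andP[pq qr] := toggle_strip iN ri tail_eq pq' q'r.
  rewrite q'K in pq qr; rewrite pq qr /=; move: q'i.
  rewrite (row_toggle iN ri tail_eq) // eqxx.
  by move: (vstripP _ _ qr i); lia.
move=> /andP[/andP[pq qr] /eqP qi].
rewrite (toggle_strip iN ri tail_eq) // (toggleK iN ri tail_eq) // eqxx andbT.
by rewrite (row_toggle iN ri tail_eq) // eqxx qi; lia.
Qed.

(** * Commutation of all transfer matrices *)

Definition transfer_mx (a : bool * R) : 'M[R]_#|{: bpart}| :=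
  \matrix_(i, j) transfer a (enum_val i) (enum_val j).

Lemma transfer_mxM a b i j : (transfer_mx a *m transfer_mx b) i j =
  \sum_q transfer a (enum_val i) q * transfer b q (enum_val j).
Proof.
rewrite mxE [RHS](reindex _ (onW_bij _ (enum_val_bij bpart))) /=.
by apply: eq_bigr => k _; rewrite !mxE.
Qed.

(** As [C] is a two-sided inverse of [B], AC = CBAC = CABC = CA. *)
Lemma comm_mx_inv n (A B C : 'M[R]_n) :
  comm_mx A B -> B *m C = 1%:M -> comm_mx A C.
Proof.
move=> AB BC1; have CB1 := mulmx1C BC1.
rewrite /comm_mx -[LHS]mul1mx -CB1 -mulmxA [B *m _]mulmxA -AB.
by rewrite -mulmxA BC1 mulmx1.
Qed.

Lemma transfer_mx_hv x :
  transfer_mx (false, - x) *m transfer_mx (true, x) = 1%:M.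
Proof.
apply/matrixP => i j; rewrite transfer_mxM -{2}[x]opprK transfer_hv_inv.
by rewrite !mxE (inj_eq enum_val_inj).
Qed.

(* [transfer_mx (true, x)] is the inverse of [transfer_mx (false, - x)], so
   that every commutation follows from the one of the horizontal strips. *)
Lemma transfer_mx_comm a b : comm_mx (transfer_mx a) (transfer_mx b).
Proof.
have hh x y : comm_mx (transfer_mx (false, x)) (transfer_mx (false, y)).
  by apply/matrixP => i j; rewrite !transfer_mxM transfer_hh_comm.
have hv x y : comm_mx (transfer_mx (false, x)) (transfer_mx (true, y)).
  exact: comm_mx_inv (hh _ _) (transfer_mx_hv y).
case: a b => [[] x] [[] y] //; last exact/comm_mx_sym.
exact: comm_mx_inv (comm_mx_sym (hv _ _)) (transfer_mx_hv y).
Qed.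

Lemma transfer_comm a b p r :
  \sum_q transfer a p q * transfer b q r =
  \sum_q transfer b p q * transfer a q r.
Proof.
have := transfer_mx_comm a b => /matrixP/(_ (enum_rank p) (enum_rank r)).
by rewrite !transfer_mxM !enum_rankK.
Qed.

(* Generating function of the tableaux of shape [p]; the head of the word is
   the largest letter. *)
Fixpoint word_sum (L : seq (bool * R)) p : R :=
  if L is a :: L' then \sum_q transfer a p q * word_sum L' q
  else (p == bpart0)%:R.

Lemma word_sum_swap L1 a b L2 p :
  word_sum (L1 ++ a :: b :: L2) p = word_sum (L1 ++ b :: a :: L2) p.
Proof.
elim: L1 p => [|c L1 IHL] p /=; last by apply: eq_bigr => q _; rewrite IHL.
under eq_bigr do rewrite mulr_sumr; rewrite exchange_big /=.
under [RHS]eq_bigr do rewrite mulr_sumr; rewrite [RHS]exchange_big /=.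
apply: eq_bigr => q _; under eq_bigr do rewrite mulrA.
under [RHS]eq_bigr do rewrite mulrA.
by rewrite -!mulr_suml transfer_comm.
Qed.

Lemma word_sum_rot L1 a L2 p :
  word_sum (L1 ++ a :: L2) p = word_sum (a :: L1 ++ L2) p.
Proof.
elim: L1 p => [//|b L1 IHL] p.
rewrite -(word_sum_swap [::] b a (L1 ++ L2)) /=.
by apply: eq_bigr => q _; rewrite IHL.
Qed.

Section Corners.

Variable p : bpart.
Hypothesis hv : hstrip p =1 vstrip p.

(** The hypothesis [hv] concerns the shape [p] only, hence the first strip removed; smaller shapes
    may violate it. So each letter is rotated to the head of the word before its prime is
    dropped. *)
Lemma word_sum_unprime L :
  word_sum L p = word_sum [seq (false, a.2) | a <- L] p.
Proof.
suff unprime L1 : word_sum (L1 ++ L) p =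
    word_sum (L1 ++ [seq (false, a.2) | a <- L]) p by exact: (unprime [::]).
elim: L L1 => [//|[s x] L IHL] L1 /=.
rewrite -(cat_rcons (false, x)) -IHL cat_rcons !word_sum_rot /=.
by apply: eq_bigr => q _; rewrite /transfer; case: s => //=; rewrite hv.
Qed.

End Corners.

End Transfer.

End BoundedPartitions.

(** * Tableaux as chains of partitions *)

Section Tableaux.

Variable la : intpart.

Lemma nth_part_le i j : (i <= j)%N -> (nth 0 la j <= nth 0 la i)%N.
Proof.
move=> ij; have [jN|Nj] := ltnP j (size la); last by rewrite (nth_default _ Nj).
case: la jN => s /= /andP[s_sorted _] jN.
apply: (sorted_leq_nth _ _ _ s_sorted) => //; rewrite ?inE //.
- by move=> x y z xy yz; apply: leq_trans yz xy.
- by apply: leqnn.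
exact: leq_ltn_trans ij jN.
Qed.

Lemma nth_part_gt0 i : (i < size la)%N -> (0 < nth 0 la i)%N.
Proof.
case: la => s /= /andP[_ s0] iN; rewrite lt0n; apply: contraNneq s0 => <-.
exact: mem_nth.
Qed.

Let N := size la.
Let M := nth 0%N la 0.
Let bpart := bpart N M.
Implicit Types (p q : bpart) (b c : box la).

Definition bpart_of : bpart := mk_bpart N M (nth 0%N la).

Lemma row_bpart_of i : row bpart_of i = nth 0%N la i.
Proof.
have [iN|Ni] := ltnP i N; last by rewrite row_default // nth_default.
rewrite row_mk_bpart // => [j k /andP[jk _]|j _]; exact: nth_part_le.
Qed.

Lemma bcol_lt b : (bcol b < nth 0 la (brow b))%N.
Proof. by rewrite /bcol /brow; case: b => i j /=; exact: ltn_ord. Qed.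

Lemma box_exists i j : (j < nth 0 la i)%N ->
  exists b : box la, brow b = i /\ bcol b = j.
Proof.
move=> ji; have iN : (i < size la)%N.
  by rewrite ltnNge; apply: contraL ji => Ni; rewrite nth_default.
pose jo : 'I_(nth 0%N la (Ordinal iN)) := Ordinal ji.
by exists (Tagged (fun i : 'I_(size la) => 'I_(nth 0%N la i)) jo).
Qed.

Definition in_bpart q b : bool := (bcol b < row q (brow b))%N.

Lemma card_in_bpart q : (forall i, row q i <= nth 0 la i)%N ->
  #|[set b | in_bpart q b]| = size_of q.
Proof.
move=> q_le; rewrite cardsE -sum1_card /size_of.
pose Q (i : 'I_N) (j : 'I_(nth 0%N la i)) := (j < row q i)%N.
have := sig_big_dep (op := addn) xpredT Q (fun _ _ => 1%N).
rewrite (eq_bigl (in_bpart q)) // => <-.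
apply: eq_bigr => i _; rewrite sum1_card /Q -[RHS]card_ord.
have w_inj : injective (widen_ord (q_le i)).
  by move=> j k /(congr1 val) jk; apply: val_inj.
rewrite -(card_imset _ w_inj).
apply: eq_card => j; apply/idP/imsetP => [jq|[j' _ ->]]; last exact: ltn_ord j'.
by exists (Ordinal jq) => //; apply/val_inj.
Qed.

Lemma box_eq b c : brow b = brow c -> bcol b = bcol c -> b = c.
Proof.
case: b c => [i j] [i' j']; rewrite /brow /bcol /= => /val_inj ii'.
by case: i' / ii' j' => j' /val_inj ->.
Qed.

Lemma in_bpart_inj p q : (forall i, row p i <= nth 0 la i)%N ->
  (forall i, row q i <= nth 0 la i)%N -> in_bpart p =1 in_bpart q -> p = q.
Proof.
move=> p_le q_le pq; apply: bpart_eq => i _.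
have le_row p1 p2 : (forall i, row p1 i <= nth 0 la i)%N ->
    in_bpart p1 =1 in_bpart p2 -> (row p1 i <= row p2 i)%N.
  move=> p1_le p12; rewrite leqNgt; apply/negP => p21.
  have [b [bi bj]] := box_exists (leq_trans p21 (p1_le i)).
  by have := p12 b; rewrite /in_bpart bi bj p21 ltnn.
by apply/eqP; rewrite eqn_leq !le_row // => b; rewrite pq.
Qed.

(** The predicate [s] selects the primed letters, so that one recursion covers both kinds of
    tableaux: [s] is constantly false for ordinary ones and [leq k] for hook ones. *)
Definition ss_pair (s : nat -> bool) n (T : filling la n) b c : bool :=
  (same_row_lt b c ==> (T b <= T c)%N && (s (T b) ==> (T b != T c))) &&
  (same_col_lt b c ==> (T b <= T c)%N && (~~ s (T b) ==> (T b != T c))).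

(* Fillings of the boxes of [p] by letters below [m]; the boxes of [la]
   outside [p] hold the dummy letter [n]. *)
Definition partial_tab s n m p (T : filling la n.+1) : bool :=
  [forall b, if in_bpart p b then (T b < m)%N else (T b == n :> nat)] &&
  [forall b, forall c, in_bpart p b && in_bpart p c ==> ss_pair s T b c].

(** * Removing the largest letter of a tableau *)

Section Recursion.

Variables (s : nat -> bool) (n : nat).
Implicit Types (T : filling la n.+1).

Lemma partial_tab_mono m p T b c : (m <= n)%N -> partial_tab s m p T ->
  (brow b <= brow c)%N -> (bcol b <= bcol c)%N -> (T b <= T c)%N.
Proof.
move=> mn /andP[/forallP T_lt /forallP Tss] rbc cbc.
have [pc|npc] := boolP (in_bpart p c); last first.
  by have := T_lt c; rewrite (negPf npc) => /eqP ->; rewrite -ltnS.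
have pb : in_bpart p b.
  by move: pc; rewrite /in_bpart => pc; have := row_le p rbc; lia.
(* The box [d] in the row of [b] and the column of [c] splits the comparison into a row step and a
   column step. *)
have [d [rd cd]] := box_exists (leq_trans (bcol_lt c) (nth_part_le rbc)).
have pd : in_bpart p d.
  by move: pc; rewrite /in_bpart rd cd => pc; have := row_le p rbc; lia.
apply: (@leq_trans (T d)).
  have [cbd|] := eqVneq (bcol b) (bcol d); first by rewrite (@box_eq b d).
  move=> cbd; have /forallP/(_ d)/implyP := Tss b; rewrite pb pd => /(_ isT).
  rewrite /ss_pair /same_row_lt rd eqxx /= ltn_neqAle cbd cd cbc.
  by move=> /andP[/andP[]].
have [rdc|] := eqVneq (brow d) (brow c); first by rewrite (@box_eq d c).
move=> rdc; have /forallP/(_ c)/implyP := Tss d; rewrite pc pd => /(_ isT).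
rewrite /ss_pair /same_col_lt cd eqxx /= ltn_neqAle rdc rd rbc /=.
by move=> /andP[_ /andP[]].
Qed.

(** Each row length is a maximum over the boxes with letters below [m]; by monotonicity these boxes
    are left-justified and form a Young diagram, so the maximum counts them. *)
Definition below m T : bpart :=
  mk_bpart N M (fun i => \max_(b | (brow b == i) && (T b < m)%N) (bcol b).+1)%N.

Section Below.

Variables (m : nat) (p : bpart) (T : filling la n.+1).
Hypotheses (mn : (m < n)%N) (T_tab : partial_tab s m.+1 p T).

Let inp b : (T b < m)%N -> in_bpart p b.
Proof.
case/andP: T_tab => /forallP/(_ b) + _; case: ifP => // _ /eqP ->.
by move: mn; lia.
Qed.

Lemma row_below i : (i < N)%N ->
  row (below m T) i = (\max_(b | (brow b == i) && (T b < m)%N) (bcol b).+1)%N.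
Proof.
apply: row_mk_bpart => [j k /andP[jk _]|j _].
  apply/bigmax_leqP => b /andP[/eqP bk Tb].
  move: jk; rewrite -bk => jk.
  have [d [rd cd]] := box_exists (leq_trans (bcol_lt b) (nth_part_le jk)).
  rewrite -cd; apply: (leq_bigmax_cond (F := fun b => (bcol b).+1)).
  rewrite rd eqxx /=; apply: leq_ltn_trans Tb.
  by apply: (partial_tab_mono mn T_tab); rewrite ?rd ?cd.
apply/bigmax_leqP => b _; apply: leq_trans (bcol_lt b) _; exact: nth_part_le.
Qed.

Lemma in_bpart_below b : in_bpart (below m T) b = (T b < m)%N.
Proof.
rewrite /in_bpart row_below; last by rewrite /brow; apply: ltn_ord.
apply/idP/idP => [|Tb]; last first.
  by apply: (leq_bigmax_cond (F := fun b => (bcol b).+1)); rewrite eqxx.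
apply: contraTT; rewrite -!leqNgt => Tb.
apply/bigmax_leqP => c /andP[/eqP rc Tc]; rewrite ltnNge; apply/negP => cc.
have := partial_tab_mono mn T_tab (b := b) (c := c).
by rewrite rc leqnn cc => /(_ isT isT); lia.
Qed.

Lemma row_below_le i : (row (below m T) i <= row p i)%N.
Proof.
have [iN|Ni] := ltnP i N; last by rewrite row_default.
rewrite row_below //; apply/bigmax_leqP => b /andP[/eqP <- Tb].
exact: inp Tb.
Qed.

Hypothesis p_le : forall i, (row p i <= nth 0 la i)%N.

Lemma top_letter b :
  in_bpart p b -> ~~ in_bpart (below m T) b -> T b = m :> nat.
Proof.
move=> pb; rewrite in_bpart_below => Tb.
by case/andP: T_tab => /forallP/(_ b); rewrite pb => + _; lia.
Qed.

(** All boxes of [p] outside [below m T] hold the letter [m]. If the strip condition failed, two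
    adjacent ones would share a row ([m] primed) or a column ([m] unprimed), where [m] may not
    repeat. *)
Lemma strip_below : strip (s m) p (below m T).
Proof.
have /andP[_ /forallP Tss] := T_tab.
case sm: (s m) => /=; apply/forallP => /= i; rewrite row_below_le ?andbT /=.
  rewrite leqNgt; apply/negP => qp.
  have pi := leq_trans qp (p_le i).
  have [c [rc cc]] := box_exists pi.
  have [b [rb cb]] := box_exists (ltnW pi).
  have pb : in_bpart p b by rewrite /in_bpart rb cb ltnW.
  have pc : in_bpart p c by rewrite /in_bpart rc cc.
  have Tb : T b = m :> nat.
    by apply: top_letter; rewrite // /in_bpart rb cb; lia.
  have Tc : T c = m :> nat.
    by apply: top_letter; rewrite // /in_bpart rc cc; lia.
  have /forallP/(_ c) := Tss b; rewrite pb pc /ss_pair Tb Tc sm.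
  rewrite /same_row_lt rb rc cb cc eqxx ltnSn /= leqnn -(inj_eq val_inj) /=.
  by rewrite Tb Tc eqxx.
rewrite leqNgt; apply/negP => qp.
have pi := leq_trans qp (row_le p (leqnSn i)).
have [c [rc cc]] := box_exists (leq_trans qp (p_le i.+1)).
have [b [rb cb]] := box_exists (leq_trans pi (p_le i)).
have pb : in_bpart p b by rewrite /in_bpart rb cb.
have pc : in_bpart p c by rewrite /in_bpart rc cc.
have Tb : T b = m :> nat by apply: top_letter; rewrite // /in_bpart rb cb; lia.
have Tc : T c = m :> nat.
  apply: top_letter; rewrite // /in_bpart rc cc.
  by have := row_le (below m T) (leqnSn i); lia.
have /forallP/(_ c) := Tss b; rewrite pb pc /ss_pair Tb Tc sm.
rewrite /same_row_lt /same_col_lt rb rc cb cc eqxx ltnn andbF ltnSn /= leqnn.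
by rewrite -(inj_eq val_inj) /= Tb Tc eqxx.
Qed.

End Below.

Section Extension.

Variables (m : nat) (p q : bpart).
Hypotheses (mn : (m < n)%N) (pq : strip (s m) p q).
Hypothesis p_le : forall i, (row p i <= nth 0 la i)%N.

Let q_le i : (row q i <= nth 0 la i)%N.
Proof. exact: leq_trans (strip_sub pq i) (p_le i). Qed.

Let inqp b : in_bpart q b -> in_bpart p b.
Proof. by rewrite /in_bpart => /leq_trans; apply; apply: strip_sub pq _. Qed.

(** With [restrict], this gives the bijection between the partial tableaux of shape [q] with letters
    below [m] and those of shape [p] with letters below [m.+1] such that [below m T = q]. *)
Definition extend T : filling la n.+1 :=
  [ffun b => if in_bpart q b then T b
             else if in_bpart p b then inord m else ord_max].

Definition restrict T : filling la n.+1 :=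
  [ffun b => if in_bpart q b then T b else ord_max].

Lemma inord_m : (inord m : 'I_n.+1) = m :> nat.
Proof. by rewrite inordK // ltnW. Qed.

Lemma partial_tab_extend T : partial_tab s m q T ->
  partial_tab s m.+1 p (extend T).
Proof.
move=> /andP[/forallP T_lt /forallP Tss].
have Tq b : in_bpart q b -> (T b < m)%N.
  by move=> qb; have := T_lt b; rewrite qb.
apply/andP; split; apply/forallP => b.
  rewrite ffunE; have [qb|_] := boolP (in_bpart q b).
    by rewrite inqp // ltnS ltnW // Tq.
  by have [pb|] := boolP (in_bpart p b); rewrite ?inord_m.
apply/forallP => c; apply/implyP => /andP[pb pc].
rewrite /ss_pair !ffunE pb pc.
have [qb|nqb] := boolP (in_bpart q b); have [qc|nqc] := boolP (in_bpart q c).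
- by have /forallP/(_ c) := Tss b; rewrite qb qc.
- have := Tq b qb; rewrite -(inj_eq val_inj) /= inord_m => Tb.
  by rewrite (ltnW Tb) (ltn_eqF Tb) /= !implybT.
- apply/andP; split; apply/implyP => /andP[/eqP bc lt_bc].
    by move: qc nqb; rewrite /in_bpart -bc; lia.
  by move: qc nqb (row_le q (ltnW lt_bc)); rewrite /in_bpart -bc; lia.
rewrite inord_m leqnn eqxx /=; move: pq.
case: (s m) => /=; rewrite ?implybT ?andbT.
  move=> /vstripP pq'; apply/implyP => /andP[/eqP bc lt_bc].
  by move: (pq' (brow b)) pc nqb nqc; rewrite /in_bpart -bc; lia.
move=> /hstripP pq'; apply/implyP => /andP[/eqP bc lt_bc].
move: (row_le p lt_bc) (pq' (brow b)) pc nqb nqc.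
by rewrite /in_bpart -bc; lia.
Qed.

Lemma below_extend T : partial_tab s m q T -> below m (extend T) = q.
Proof.
move=> T_tab; have eT_tab := partial_tab_extend T_tab.
apply: in_bpart_inj => // [i|b].
  exact: leq_trans (row_below_le mn eT_tab i) (p_le i).
rewrite (in_bpart_below mn eT_tab) ffunE.
case/andP: T_tab => /forallP/(_ b) + _; case: ifPn => // _ _.
case: ifP => _; rewrite ?inord_m ?ltnn //=.
by apply/negbTE; rewrite -leqNgt ltnW.
Qed.

Lemma restrict_extend T : partial_tab s m q T -> restrict (extend T) = T.
Proof.
move=> /andP[/forallP T_lt _]; apply/ffunP => b; rewrite !ffunE.
have := T_lt b; have [//|_ /eqP Tb] := boolP (in_bpart q b); exact: val_inj.
Qed.

Lemma extend_restrict T : partial_tab s m.+1 p T -> below m T = q ->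
  extend (restrict T) = T.
Proof.
move=> T_tab qT; apply/ffunP => b; rewrite !ffunE.
have [//|nqb] := boolP (in_bpart q b); apply/val_inj => /=.
have [pb|pb] := boolP (in_bpart p b).
  by rewrite inord_m (top_letter mn T_tab) ?qT.
by case/andP: T_tab => /forallP/(_ b) + _; rewrite (negPf pb) => /eqP.
Qed.

Lemma partial_tab_restrict T : partial_tab s m.+1 p T -> below m T = q ->
  partial_tab s m q (restrict T).
Proof.
move=> T_tab qT; apply/andP; split; apply/forallP => b.
  rewrite ffunE; have [qb|//] := boolP (in_bpart q b).
  by rewrite -(in_bpart_below mn T_tab) qT.
apply/forallP => c; apply/implyP => /andP[qb qc].
rewrite /ss_pair !ffunE qb qc.
by case/andP: T_tab => _ /forallP/(_ b)/forallP/(_ c); rewrite !inqp.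
Qed.

End Extension.

Variables (R : comNzRingType) (w : nat -> R).

Definition tab_sum m p : R :=
  \sum_(T : filling la n.+1 | partial_tab s m p T)
    \prod_(b | in_bpart p b) w (T b).

Lemma prod_extend m p q T : (m < n)%N ->
  strip (s m) p q -> (forall i, row p i <= nth 0 la i)%N ->
  \prod_(b | in_bpart p b) w (extend m p q T b) =
  w m ^+ (size_of p - size_of q) * \prod_(b | in_bpart q b) w (T b).
Proof.
move=> mn pq p_le.
have qp b : in_bpart q b -> in_bpart p b.
  by rewrite /in_bpart => /leq_trans; apply; apply: strip_sub pq _.
have q_le i : (row q i <= nth 0 la i)%N.
  exact: leq_trans (strip_sub pq i) (p_le i).
rewrite (bigID (in_bpart q)) /= mulrC; congr (_ * _); last first.
  apply: eq_big => [b|b /andP[_ qb]]; last by rewrite ffunE qb.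
  by rewrite andb_idl //; apply: qp.
rewrite (eq_bigr (fun=> w m)) => [|b /andP[pb qb]]; last first.
  by rewrite ffunE pb (negPf qb) inordK // ltnW.
rewrite prodr_const -!card_in_bpart //; congr (_ ^+ _).
rewrite -(cardsID [set b | in_bpart q b] [set b | in_bpart p b]).
rewrite (_ : _ :&: _ = [set b | in_bpart q b]); last first.
  by apply/setP => b; rewrite !inE andb_idl //; apply: qp.
rewrite addKn; apply/esym/eq_card => b.
by rewrite !inE andbC.
Qed.

Lemma tab_sumS m p : (m < n)%N -> (forall i, row p i <= nth 0 la i)%N ->
  tab_sum m.+1 p = \sum_q transfer (s m, w m) p q * tab_sum m q.
Proof.
move=> mn p_le; rewrite /tab_sum (partition_big (below m) xpredT) //=.
apply: eq_bigr => q _; rewrite /transfer /=.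
have [pq|npq] := boolP (strip (s m) p q); last first.
  rewrite !mul0r big_pred0 // => T; apply/negbTE; apply: contra npq.
  by move=> /andP[T_tab /eqP <-]; apply: strip_below.
rewrite mul1r mulr_sumr.
rewrite (reindex_onto (extend m p q) (restrict q)) /=; last first.
  by move=> T /andP[T_tab /eqP qT]; apply: extend_restrict.
apply: eq_big => [T|T _]; last exact: prod_extend.
apply/idP/idP => [/andP[/andP[eT_tab /eqP qT] /eqP <-]|T_tab].
  exact: (partial_tab_restrict (p := p)).
by rewrite partial_tab_extend // below_extend // restrict_extend // !eqxx.
Qed.

Lemma tab_sum0 p : (forall i, row p i <= nth 0 la i)%N ->
  tab_sum 0 p = (p == bpart0 N M)%:R.
Proof.
move=> p_le; rewrite /tab_sum; have [->|p_neq0] := eqVneq p (bpart0 N M).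
  have no_box b : in_bpart (bpart0 N M) b = false.
    by rewrite /in_bpart row_empty.
  rewrite (big_pred1 [ffun=> ord_max]) => [|T]; last first.
    apply/idP/eqP => [/andP[/forallP T_lt _]|->].
      apply/ffunP => b; have := T_lt b; rewrite no_box ffunE => /eqP Tb.
      exact: val_inj.
    apply/andP; split; apply/forallP => b; first by rewrite no_box ffunE.
    by apply/forallP => c; rewrite no_box.
  by rewrite big_pred0.
rewrite big_pred0 // => T; apply: contra_neqF p_neq0 => /andP[/forallP T_lt _].
apply: bpart_eq => i _; rewrite row_empty; apply/eqP; rewrite -leqn0 leqNgt.
apply/negP => p0; have [b [rb cb]] := box_exists (leq_trans p0 (p_le i)).
by have := T_lt b; rewrite /in_bpart rb cb p0.
Qed.

Lemma tab_sum_word m p : (m <= n)%N -> (forall i, row p i <= nth 0 la i)%N ->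
  tab_sum m p = word_sum (rev (mkseq (fun i => (s i, w i)) m)) p.
Proof.
elim: m p => [|m IHm] p mn p_le; first exact: tab_sum0.
rewrite mkseqS rev_rcons /= tab_sumS //; apply: eq_bigr => q _.
(* The induction hypothesis needs [q] inside [la], which the strip condition provides; otherwise the
   coefficient is zero. *)
rewrite /transfer /=; case: (boolP (strip _ _ _)) => pq; last by rewrite !mul0r.
rewrite IHm ?(ltnW mn) // => i; exact: leq_trans (strip_sub pq i) (p_le i).
Qed.

End Recursion.

Definition supertableau (s : nat -> bool) n (T : filling la n) : bool :=
  [forall b, forall c, ss_pair s T b c].

Lemma supertableau_sum (R : comNzRingType) (s : nat -> bool) n (w : nat -> R) :
  \sum_(T : filling la n | supertableau s T) \prod_b w (T b) =
  word_sum (rev (mkseq (fun i => (s i, w i)) n)) bpart_of.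
Proof.
rewrite -(@tab_sum_word s n) //; last by move=> i; rewrite row_bpart_of.
have inp b : in_bpart bpart_of b by rewrite /in_bpart row_bpart_of bcol_lt.
(* The alphabet gains the dummy letter [n], which no box receives because the shape is all of
   [la]. *)
pose up (T : filling la n) : filling la n.+1 :=
  [ffun b => widen_ord (leqnSn n) (T b)].
have up_inj : injective up.
  move=> T T' /ffunP TT'; apply/ffunP => b; apply/val_inj.
  by have /(congr1 val) := TT' b; rewrite !ffunE.
have ss_up T b c : ss_pair s (up T) b c = ss_pair s T b c.
  by rewrite /ss_pair !ffunE -!(inj_eq val_inj).
transitivity (\sum_(T in [set up T | T in [pred T | supertableau s T]])
                \prod_b w (T b)).
  rewrite big_imset; last by move=> T T' _ _; apply: up_inj.
  apply: eq_big => [T|T _]; first by rewrite inE.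
  apply: eq_bigr => b _.
  by rewrite ffunE.
apply: eq_big => [T|T _]; last by apply: eq_bigl => b; rewrite inp.
apply/imsetP/idP => [[T' T'ss ->]|/andP[/forallP T_lt /forallP Tss]].
  apply/andP; split; apply/forallP => b; first by rewrite inp ffunE /= ltn_ord.
  apply/forallP => c; rewrite !inp ss_up.
  by move: T'ss; rewrite inE => /forallP/(_ b)/forallP/(_ c).
have {}T_lt b : (T b < n)%N by have := T_lt b; rewrite inp.
have TE : T = up [ffun b => Ordinal (T_lt b)].
  by apply/ffunP => b; apply/val_inj; rewrite !ffunE.
exists [ffun b => Ordinal (T_lt b)] => //; rewrite inE.
apply/forallP => b; apply/forallP => c; rewrite -ss_up -TE.
by have /forallP/(_ c) := Tss b; rewrite !inp.
Qed.

End Tableaux.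

(** * Linear independence of Schur polynomials *)

Lemma sum_pow_eq0 (I : finType) (F : I -> rat) (d : I -> nat) :
  (forall y, \sum_i F i * y ^+ d i = 0) ->
  forall j, \sum_(i | d i == j) F i = 0.
Proof.
move=> F0 j; pose P : {poly rat} := \sum_i F i *: 'X^(d i).
have P_root y : root P y.
  rewrite /root horner_sum; apply/eqP; rewrite -[RHS](F0 y).
  by apply: eq_bigr => i _; rewrite hornerZ hornerXn.
have P0 : P = 0.
  apply/eqP; apply: contraT => /max_poly_roots P_roots.
  (* The points 0, ..., [size P - 1] are one root more than the degree allows. *)
  pose rs : seq rat := [seq i%:R | i <- iota 0 (size P)].
  have rs_uniq : uniq rs.
    by rewrite map_inj_uniq ?iota_uniq //; apply: Num.Theory.mulrIn.
  have := P_roots rs _ rs_uniq; rewrite size_map size_iota ltnn; apply.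
  by apply/allP => y _.
transitivity P`_j; last by rewrite P0 coef0.
rewrite coef_sum [LHS]big_mkcond; apply: eq_bigr => i _.
by rewrite coefZ coefXn eq_sym; case: eqP; rewrite ?mulr1 ?mulr0.
Qed.

Section Kostka.

Variables N M : nat.
Notation bpart := (bpart N M).
Implicit Types p q : bpart.

(* Number of semistandard tableaux of shape [p] with prescribed content; the
   head of the list counts the largest letter. *)
Fixpoint kostka (cs : seq nat) p : nat :=
  if cs is c :: cs' then
    (\sum_(q | hstrip p q && (size_of p - size_of q == c)) kostka cs' q)%N
  else p == bpart0 N M.

Definition schur_word (X : seq rat) : seq (bool * rat) :=
  [seq (false, x) | x <- X].

(** Coefficients are extracted one variable at a time, from the largest letter down: taking the
    power [c] of the top variable replaces [v] by [v'], its image under the transpose of the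
    transfer by horizontal strips of size [c]. *)
Lemma kostka_orthogonal (v : bpart -> rat) :
  (forall X, \sum_p v p * word_sum (schur_word X) p = 0) ->
  forall cs, \sum_p v p * (kostka cs p)%:R = 0.
Proof.
move=> v0 cs; elim: cs v v0 => [|c cs IHcs] v v0; first exact: (v0 [::]).
pose v' q := \sum_(p | hstrip p q && (size_of p - size_of q == c)%N) v p.
rewrite -[RHS](IHcs v') => [|X].
  under eq_bigr do rewrite /= natr_sum mulr_sumr big_mkcond.
  rewrite exchange_big /=; apply: eq_bigr => q _.
  by rewrite -big_mkcond /= mulr_suml.
pose F (pq : bpart * bpart) :=
  (hstrip pq.1 pq.2)%:R * v pq.1 * word_sum (schur_word X) pq.2.
pose d (pq : bpart * bpart) := (size_of pq.1 - size_of pq.2)%N.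
rewrite -[RHS](@sum_pow_eq0 _ F d _ c) => [|y].
  under eq_bigr do rewrite mulr_suml big_mkcond.
  rewrite exchange_big pair_big [RHS]big_mkcond /=.
  apply: eq_bigr => -[p q] _; rewrite /F /d /=.
  by case: hstrip; rewrite ?mul1r // !mul0r if_same.
rewrite -[RHS](v0 (y :: X)) /=; under [RHS]eq_bigr do rewrite mulr_sumr.
rewrite pair_big /=; apply: eq_bigr => -[p q] _; rewrite /F /d /transfer /=.
by ring.
Qed.

(** The statistic usually written n(p). It decreases strictly as [p] goes up in dominance order, and
    serves as a numerical substitute for that order. *)
Definition moment p : nat := (\sum_(i < N) i * row p i)%N.

(** The sum of the indices of all letters, the smallest letter having index 0. *)
Fixpoint content_moment (cs : seq nat) : nat :=
  if cs is c :: cs' then size cs' * c + content_moment cs' else 0%N.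

(* A letter of index [i] lies in one of the rows [0, ..., i]. *)
Lemma kostka_moment cs p : (0 < kostka cs p)%N ->
  [/\ forall i, (size cs <= i)%N -> row p i = 0%N,
      (moment p <= content_moment cs)%N &
      moment p = content_moment cs -> forall i, row p i = nth 0%N (rev cs) i].
Proof.
elim: cs p => [|c cs IHcs] p /=.
  case: eqP => // -> _; split=> [i _| |_ i]; rewrite ?row_empty ?nth_nil //.
  by rewrite /moment big1 // => i _; rewrite row_empty muln0.
rewrite lt0n sum_nat_eq0 negb_forall => /existsP[q].
rewrite negb_imply -lt0n => /andP[/andP[pq /eqP pqc] /IHcs[q_tail q_le q_eq]].
have qp := strip_sub (s := false) pq.
have p_tail i : (size cs < i)%N -> row p i = 0%N.
  case: i => // i si; have := hstripP _ _ pq i; rewrite q_tail //.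
  by case/andP; rewrite leqn0 => /eqP.
have size_pq : (c + size_of q)%N = size_of p.
  by have := strip_size (s := false) pq; lia.
(* The first sum adds up letter index minus row index over the boxes holding the largest letter.
   When the moments agree it vanishes, so all these boxes lie in row [size cs]. *)
have slack : (\sum_(i < N) (size cs - i) * (row p i - row q i) + moment p =
    size cs * c + moment q)%N.
  suff: (\sum_(i < N) (size cs - i) * (row p i - row q i) + moment p
      + size cs * size_of q = size cs * size_of p + moment q)%N.
    by rewrite -size_pq; lia.
  rewrite /moment /size_of !big_distrr -!big_split /=; apply: eq_bigr => i _.
  have := qp i; have [is_le|/p_tail pi0] := leqP i (size cs); last first.
    by rewrite pi0 leqn0 => /eqP ->; rewrite !muln0.
  by move: is_le; move: (size cs) (row p i) (row q i) => s a b; nia.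
split=> [//| |pE i]; first by lia.
have qE : moment q = content_moment cs by lia.
have := slack; rewrite pE => /eqP.
rewrite qE -[X in _ == X]add0n eqn_add2r sum_nat_eq0 => /forallP slack0.
rewrite rev_cons nth_rcons size_rev -q_eq //.
have pqi j : (j < size cs)%N -> row p j = row q j.
  move=> js; have [jN|Nj] := ltnP j N; last by rewrite !row_default.
  have := slack0 (Ordinal jN); have := qp j; rewrite /= muln_eq0.
  by rewrite !subn_eq0; lia.
case: ltngtP => [|/p_tail //|->]; first exact: pqi.
move: size_pq; have [sN|Ns] := ltnP (size cs) N; last first.
  have -> : size_of p = size_of q.
    by apply: eq_bigr => j _; rewrite pqi // (leq_trans _ Ns).
  by rewrite row_default //; lia.
rewrite !(size_ofD1 _ sN) (q_tail (size cs)) //.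
have -> : (\sum_(j < N | j != size cs :> nat) row p j =
    \sum_(j < N | j != size cs :> nat) row q j)%N.
  apply: eq_bigr => j js; have [|sj|sj] := ltngtP j (size cs).
  - exact: pqi.
  - by rewrite p_tail // q_tail // ltnW.
  by rewrite sj eqxx in js.
by move: (\sum_(j < N | _) _)%N => S; lia.
Qed.

(** The tableau whose row [i] is filled with the letter [i] has this content; stripping its largest
    letter deletes the last row, whence the truncation [f]. *)
Lemma kostka_diag p m : (forall i, (m <= i)%N -> row p i = 0%N) ->
  (0 < kostka (rev (mkseq (row p) m)) p)%N.
Proof.
elim: m p => [|m IHm] p p_tail.
  suff -> : p = bpart0 N M by rewrite /= eqxx.
  by apply: bpart_eq => i _; rewrite p_tail // row_empty.
rewrite mkseqS rev_rcons /= lt0n sum_nat_eq0 negb_forall; apply/existsP.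
pose f i := if (i < m)%N then row p i else 0%N.
have pf i : (i < N)%N -> (row p i.+1 <= f i <= row p i)%N.
  rewrite /f; case: (ltnP i m) => [_ _|mi _]; first by rewrite leqnn row_le.
  by rewrite p_tail // leqW.
exists (mk_bpart N M f); have rowf := interlacing_bpart pf.
rewrite negb_imply -lt0n; apply/andP; split; last first.
  suff -> : mkseq (row p) m = mkseq (row (mk_bpart N M f)) m.
    apply: IHm => i mi; have [iN|Ni] := ltnP i N; last exact: row_default.
    by rewrite rowf // /f ltnNge mi.
  apply/eq_in_map => i; rewrite mem_iota add0n => /andP[_ im].
  have [iN|Ni] := ltnP i N; last by rewrite !row_default.
  by rewrite rowf // /f im.
apply/andP; split; first by apply/forallP => /= i; rewrite rowf // pf.
have [mN|Nm] := ltnP m N; last first.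
  rewrite (row_default p Nm) subn_eq0; apply: leq_sum => i _.
  by rewrite rowf // /f (leq_trans _ Nm).
rewrite !(size_ofD1 _ mN).
rewrite (rowf m) // {1}/f ltnn add0n.
rewrite [X in (_ - X)%N](eq_bigr (fun i : 'I_N => row p i)) ?addnK // => i im.
rewrite rowf // /f; case: ltngtP => // [mi|im']; first by rewrite p_tail.
by rewrite im' eqxx in im.
Qed.

Lemma content_moment_mkseq (f : nat -> nat) m :
  content_moment (rev (mkseq f m)) = (\sum_(i < m) i * f i)%N.
Proof.
elim: m => [|m IHm]; first by rewrite big_ord0.
by rewrite mkseqS rev_rcons /= IHm big_ord_recr /= size_rev size_mkseq addnC.
Qed.

Lemma schur_free (v : bpart -> rat) :
  (forall X, \sum_p v p * word_sum (schur_word X) p = 0) -> forall p, v p = 0.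
Proof.
move=> v0 p0; apply/eqP; apply: contraT => vp0.
(* Take [p] of least moment in the support of [v], and its rows as content. A shape [q] in the
   support with nonzero Kostka number has moment at most that of [p], hence equal to it, and then
   [q = p]. *)
case: (@arg_minnP _ p0 (fun p => v p != 0) moment vp0) => p vp p_min.
have /eqP := kostka_orthogonal v0 (rev (mkseq (row p) N)).
have p_tail i : (N <= i)%N -> row p i = 0%N by exact: row_default.
rewrite (bigD1 p) //= big1 ?addr0 => [|q q_neq_p].
  rewrite mulf_eq0 (negPf vp) Num.Theory.pnatr_eq0 eqn0Ngt.
  by rewrite kostka_diag.
have [->|vq] := eqVneq (v q) 0; first by rewrite mul0r.
have [->|] := eqVneq (kostka (rev (mkseq (row p) N)) q) 0%N.
  by rewrite mulr0.
rewrite -lt0n => /kostka_moment[_]; rewrite content_moment_mkseq => q_le q_eq.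
case/eqP: q_neq_p; apply: bpart_eq => i iN.
rewrite q_eq ?revK ?nth_mkseq //; apply/eqP.
by rewrite eqn_leq q_le p_min.
Qed.

End Kostka.

(** * Doubly symmetric Schur functions *)

Section SchurPolynomials.

Variable la : intpart.

Lemma filling_weightE n (T : filling la n) :
  filling_weight T = \prod_b 'X_(T b) :> {mpoly rat[n]}.
Proof.
rewrite /filling_weight (partition_big T xpredT) //=; apply: eq_bigr => i _.
rewrite -prodr_const; apply: eq_big => b; first by rewrite inE.
by rewrite inE => /eqP ->.
Qed.

Lemma semistandardE n (T : filling la n) :
  semistandard T = supertableau (fun=> false) T.
Proof.
apply: eq_forallb => b; apply: eq_forallb => c.
rewrite /ss_pair /= andbT -(inj_eq val_inj) /=; congr (_ && (_ ==> _)).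
by rewrite ltn_neqAle andbC.
Qed.

Lemma hook_semistandardE k l (T : filling la (k + l)) :
  hook_semistandard T = supertableau (leq k) T.
Proof.
apply: eq_forallb => b; apply: eq_forallb => c.
by rewrite /ss_pair -ltnNge.
Qed.

Definition var n (i : nat) : {mpoly rat[n]} :=
  if insub i is Some i' then 'X_i' else 0.

Lemma sum_weight_var n s :
  \sum_(T : filling la n | supertableau s T) filling_weight T =
  word_sum (rev (mkseq (fun i => (s i, var n i)) n)) (bpart_of la).
Proof.
rewrite -supertableau_sum; apply: eq_bigr => T _; rewrite filling_weightE.
by apply: eq_bigr => b _; rewrite /var valK.
Qed.

Lemma meval_sum_weight n s (v : nat -> rat) :
  (\sum_(T : filling la n | supertableau s T) filling_weight T).@[v] =
  word_sum (rev (mkseq (fun i => (s i, v i)) n)) (bpart_of la).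
Proof.
rewrite -supertableau_sum rmorph_sum /=; apply: eq_bigr => T _.
rewrite filling_weightE rmorph_prod /=.
by apply: eq_bigr => b _; rewrite mevalXU.
Qed.

Lemma doubly_symmetric_schur : doubly_symmetric (schur la) <->
  forall k l, \sum_(T : filling la (k + l) | supertableau (fun=> false) T)
                filling_weight T =
              \sum_(T : filling la (k + l) | supertableau (leq k) T)
                filling_weight T.
Proof.
split=> H k l; have := H k l; rewrite /schur !liftU !scale1r.
  rewrite /schur_poly /hook_schur_poly.
  under eq_bigl do rewrite semistandardE.
  by under [X in _ = X -> _]eq_bigl do rewrite hook_semistandardE.
rewrite /schur_poly /hook_schur_poly.
under [X in _ -> X = _]eq_bigl do rewrite semistandardE.
by under [X in _ -> _ = X]eq_bigl do rewrite hook_semistandardE.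
Qed.

(** Consecutive rows of a staircase differ by one, so both conditions let row [i] lose at most one
    box; below the last row both force zero. *)
Lemma staircase_strips : staircase la ->
  hstrip (bpart_of la) =1 vstrip (bpart_of la).
Proof.
case=> m la_m q; have rowE i : row (bpart_of la) i = (m - i)%N.
  rewrite row_bpart_of la_m; have [im|mi] := ltnP i m.
    by rewrite nth_rev ?size_iota // nth_iota ?subnS; lia.
  by rewrite nth_default ?size_rev ?size_iota //; lia.
by apply/hstripP/vstripP => pq i; move: (pq i); rewrite !rowE; lia.
Qed.

Lemma doubly_symmetric_staircase : staircase la -> doubly_symmetric (schur la).
Proof.
move=> /staircase_strips hv; apply/doubly_symmetric_schur => k l.
rewrite !sum_weight_var [RHS](word_sum_unprime hv) map_rev.
congr (word_sum (rev _) _).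
by rewrite /mkseq -map_comp.
Qed.

(* Adding a single primed letter [y] to unprimed ones and extracting the
   coefficient of [y ^ 2]. *)
Lemma strips2_eq : doubly_symmetric (schur la) ->
  forall q, (size_of (bpart_of la) - size_of q = 2)%N ->
    hstrip (bpart_of la) q = vstrip (bpart_of la) q.
Proof.
move=> /doubly_symmetric_schur ds q q2; set p := bpart_of la in q2 *.
pose h r : rat := (hstrip p r)%:R - (vstrip p r)%:R.
pose d (r : bpart (size la) (nth 0%N la 0%N)) := (size_of p - size_of r)%N.
suff : (if d q == 2 then h q else 0) = 0.
  rewrite /d q2 eqxx /h => /eqP; rewrite subr_eq0 Num.Theory.eqr_nat.
  by case: hstrip; case: vstrip.
(* The vector is supported on the shapes obtained by removing two boxes, with the difference of the
   two strip indicators as entries. *)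
apply: (schur_free (v := fun r => if d r == 2 then h r else 0)) => X.
under eq_bigr do rewrite (fun_if (fun u => u * _)) mul0r.
rewrite -big_mkcond; apply: sum_pow_eq0 => y.
(* Words list the largest letter first, hence the reversal of [X]; the single primed letter has
   index [size X] and value [y]. *)
pose v i := nth 0 (rcons (rev X) y) i.
have := congr1 (meval v) (ds (size X) 1%N).
rewrite !meval_sum_weight addn1 !mkseqS !rev_rcons.
have vy : v (size X) = y by rewrite /v nth_rcons size_rev ltnn eqxx.
have vX s : (forall i, (i < size X)%N -> s i = false) ->
    rev (mkseq (fun i => (s i, v i)) (size X)) = schur_word X.
  move=> sF; rewrite -[X in schur_word X]revK /schur_word map_rev.
  congr (rev _); apply: (@eq_from_nth _ (false, 0)).
    by rewrite size_mkseq size_map size_rev.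
  move=> i; rewrite size_mkseq => iX; rewrite nth_mkseq // sF //.
  by rewrite (nth_map 0) ?size_rev // /v nth_rcons size_rev iX.
rewrite !vX ?vy ?leqnn // => [/=|i iX]; last by rewrite leqNgt iX.
move=> /eqP; rewrite -subr_eq0 -sumrB => /eqP sub0; rewrite -[RHS]sub0.
by apply: eq_bigr => r _; rewrite /transfer /h /d /=; ring.
Qed.

(** * From strips of size two to the staircase shape *)

Lemma staircase_of_parts :
  (forall i, (i < size la)%N -> nth 0%N la i = (nth 0%N la i.+1).+1) ->
  staircase la.
Proof.
move=> la_succ; exists (size la).
apply: (@eq_from_nth _ 0%N); first by rewrite size_rev size_iota.
move=> i iN; rewrite nth_rev size_iota // nth_iota ?subnS; last by lia.
suff : forall j, (j <= size la)%N -> nth 0%N la (size la - j) = j.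
  move=> /(_ _ (leq_subr i _)); rewrite subKn 1?ltnW // => ->; lia.
elim=> [|j IHj] jN; first by rewrite nth_default // subn0.
rewrite la_succ; last by lia.
by rewrite subnSK // IHj // ltnW.
Qed.

Lemma doubly_symmetric_gap i : doubly_symmetric (schur la) ->
  (i < size la)%N -> (nth 0 la i <= (nth 0 la i.+1).+1)%N.
Proof.
move=> ds iN; rewrite leqNgt; apply/negP => gap.
(* The last two boxes of row [i] form a horizontal strip, as the row stays at least as long as the
   next one; it is not vertical. *)
pose f j := if j == i then (nth 0 la i - 2)%N else nth 0%N la j.
pose q := mk_bpart (size la) (nth 0%N la 0) f.
have rowq j : (j < size la)%N -> row q j = f j.
  apply: (interlacing_bpart (p := bpart_of la)) => k _.
  rewrite !row_bpart_of /f; case: eqVneq => [->|_]; first by lia.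
  by rewrite leqnn nth_part_le.
have hq : hstrip (bpart_of la) q.
  apply/forallP => /= j; rewrite rowq // !row_bpart_of /f.
  by case: eqVneq => [->|_]; [lia|rewrite leqnn nth_part_le].
have size_q : (size_of (bpart_of la) - size_of q = 2)%N.
  rewrite !(size_ofD1 _ iN) row_bpart_of rowq // /f eqxx.
  rewrite [X in (_ - (_ + X))%N](eq_bigr
    (fun j : 'I_(size la) => row (bpart_of la) j)).
    by move: (\sum_(j < _ | _) _)%N => S; lia.
  by move=> j ji; rewrite rowq // /f ifN // row_bpart_of.
have := strips2_eq ds size_q; rewrite hq => /esym/vstripP/(_ i).
by rewrite rowq // /f eqxx row_bpart_of; lia.
Qed.

Lemma doubly_symmetric_strict i : doubly_symmetric (schur la) ->
  (i < size la)%N -> nth 0%N la i != nth 0%N la i.+1.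
Proof.
move=> ds iN; apply/negP => i_eq.
pose P j := (j < size la)%N && (nth 0%N la j == nth 0%N la j.+1).
have exP : exists j, P j by exists i; rewrite /P iN.
have ubP j : P j -> (j <= size la)%N by case/andP=> /ltnW.
case: (ex_maxnP exP ubP) => {i iN i_eq exP ubP} i /andP[iN /eqP i_eq] imax.
have i_gt0 := nth_part_gt0 iN.
have i1N : (i.+1 < size la)%N.
  by rewrite ltnNge; apply: contraL i_gt0 => Ni; rewrite i_eq nth_default.
(* By maximality of [i], row [i.+1] is strictly longer than row [i.+2], so the last boxes of rows
   [i] and [i.+1] can both be removed. *)
have i1_gt : (nth 0 la i.+2 < nth 0 la i.+1)%N.
  rewrite ltn_neqAle nth_part_le // andbT eq_sym; apply/negP => i1_eq.
  by have := imax i.+1; rewrite /P i1N i1_eq ltnn => /(_ isT).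
pose f j := if (j == i) || (j == i.+1) then (nth 0%N la i).-1 else nth 0%N la j.
pose q := mk_bpart (size la) (nth 0%N la 0) f.
have f_le j : (f j <= nth 0 la j)%N.
  by rewrite /f; case: eqVneq => [->|_] /=; [|case: eqVneq => [->|_] /=]; lia.
have rowq j : (j < size la)%N -> row q j = f j.
  apply: row_mk_bpart => [a b /andP[ab bN]|a _]; last first.
    exact: leq_trans (f_le a) (nth_part_le la (leq0n a)).
  have := nth_part_le la ab; have [ab2|] := leqP i.+2 b.
    have := nth_part_le la ab2; rewrite /f.
    by do !case: eqVneq => //= *; subst; lia.
  by rewrite /f; do !case: eqVneq => //= *; subst; lia.
have vq : vstrip (bpart_of la) q.
  apply/forallP => /= j; rewrite rowq // !row_bpart_of /f.
  by move: (nat_of_ord j) => {}j; do !case: eqVneq => //= *; subst; lia.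
have size_q : (size_of (bpart_of la) - size_of q = 2)%N.
  suff : size_of (bpart_of la) = (size_of q + 2)%N by lia.
  transitivity (size_of q +
      \sum_(j < size la) ((j == i :> nat) + (j == i.+1 :> nat)))%N.
    rewrite -big_split; apply: eq_bigr => j _ /=.
    rewrite rowq // row_bpart_of /f.
    by move: (nat_of_ord j) => {}j; do !case: eqVneq => //= *; subst; lia.
  rewrite big_split /= -!big_mkcond.
  by rewrite (big_pred1 (Ordinal iN)) // (big_pred1 (Ordinal i1N)).
(* A horizontal strip would require [row q i] to be at least row [i.+1] of [la], but it is one
   less. *)
have := strips2_eq ds size_q; rewrite vq => /hstripP/(_ i).
by rewrite rowq // /f eqxx !row_bpart_of /=; lia.
Qed.

End SchurPolynomials.

Theorem corollary3p10 (la : intpart) :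
  doubly_symmetric (schur la) <-> staircase la.
Proof.
split=> [ds|]; last exact: doubly_symmetric_staircase.
apply: staircase_of_parts => i iN; apply/eqP; rewrite eqn_leq.
rewrite doubly_symmetric_gap //= ltn_neqAle nth_part_le // andbT eq_sym.
exact: doubly_symmetric_strict.
Qed.
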